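(* For every integer $M>0$ there exists an integer $N=N(M)$ such that for all positive integers $m,n$ with $\min(m,n)>N$, the polynomial $W(P_{m,n},t)$ has more than $M$ non-real zeros (counted in $\mathbb{C}$).
   Context: For a partial order $\preceq$ on $[p]=\{1,2,\ldots,p\}$ (with strict part $\prec$), a linear extension is a permutation $\pi$ of $[p]$ (written in one-line notation $(\pi(1),\ldots,\pi(p))$) such that $i\prec j$ implies $\pi^{-1}(i)<\pi^{-1}(j)$; let $\mathcal{L}(P)$ denote the set of linear extensions of the poset $P$. A descent of $\pi$ is an index $i\in[p-1]$ with $\pi(i)>\pi(i+1)$ (usual order of integers), and $\operatorname{des}(\pi)$ is the number of descents. The $W$-polynomial of $P$ is $W(P,t)=\sum_{\pi\in\mathcal{L}(P)} t^{\operatorname{des}(\pi)}$. For positive integers $m,n$, let $P_{m,n}$ be the poset on $[m+n]$ whose order is generated (via transitive closure) by the chain relations $1\prec 2\prec\cdots\prec m$, the chain relations $m+1\prec m+2\prec\cdots\prec m+n$, and the additional relation $m+1\prec m$. *)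

(* Defs.v *)
From mathcomp Require Import all_boot all_order all_fingroup all_algebra.

Set Implicit Arguments.
Unset Strict Implicit.
Unset Printing Implicit Defensive.

(* The ground set [p] = {1, ..., p} is encoded as 'I_p = {0, ..., p.-1}: the
   ordinal i stands for the label i + 1. This shift preserves the order of the
   labels, hence descents. A permutation s : 'S_p is the word
   (s 0, ..., s (p.-1)) in one-line notation. *)

Definition linear_extensions (p : nat) (le : rel 'I_p) : {set 'S_p} :=
  [set s : 'S_p | [forall i : 'I_p, forall j : 'I_p,
     (le i j && (i != j)) ==> ((s^-1)%g i < (s^-1)%g j)]].

Definition des (p : nat) (s : 'S_p) : nat :=
  #|[set i : 'I_p | [exists j : 'I_p, (j == i.+1 :> nat) && (s j < s i)]]|.

Definition Wpoly (R : nzRingType) (p : nat) (le : rel 'I_p) : {poly R} :=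
  (\sum_(s in linear_extensions le) 'X^(des s))%R.

(* The generating relations of P_{m,n}. After the shift of labels, the chains
   are 0, ..., m.-1 and m, ..., m + n - 1, and the third clause is the relation
   between the labels m + 1 and m. *)
Definition Pmn_gen (m n : nat) : rel 'I_(m + n) := fun i j =>
  [|| (j == i.+1 :> nat) && (j < m),
      (j == i.+1 :> nat) && (m <= i)
    | (i == m :> nat) && (j.+1 == m)].

Definition Pmn_le (m n : nat) : rel 'I_(m + n) := connect (@Pmn_gen m n).

Lemma Pmn_le_refl (m n : nat) : reflexive (@Pmn_le m n).
Proof. exact: connect0. Qed.

Lemma Pmn_le_trans (m n : nat) : transitive (@Pmn_le m n).
Proof. exact: connect_trans. Qed.

Lemma Pmn_le_anti (m n : nat) : antisymmetric (@Pmn_le m n).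
Proof.
pose h (i : 'I_(m + n)) : nat := if i.+1 == m then m + n else (i : nat).
have hS i j : Pmn_gen i j -> h i < h j.
  rewrite /Pmn_gen /h; case/or3P => /andP[/eqP e1 e2].
  - have ni : (i.+1 == m) = false by rewrite -e1 ltn_eqF.
    rewrite ni; case: ifP => _; first exact: ltn_ord.
    by rewrite e1.
  - have ni : (i.+1 == m) = false by rewrite gtn_eqF.
    have nj : (j.+1 == m) = false by rewrite e1 gtn_eqF // ltnS ltnW.
    by rewrite ni nj e1.
  - by rewrite e2 e1 gtn_eqF // -{1}e1 ltn_ord.
have hP x p : path (@Pmn_gen m n) x p -> h x <= h (last x p) ?= iff (p == [::]).
  elim: p x => [|y p IH] x /=; first by move=> _; split; rewrite ?leqnn ?eqxx.
  case/andP=> /hS xy /IH [yl _]; have lt := leq_trans xy yl.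
  by split; rewrite ?(ltnW lt) ?(ltn_eqF lt).
move=> x y /andP[/connectP[p /hP pp ->] /connectP[q /hP qq e]].
have [] := pp; rewrite eqn_leq => -> /=; have [] := qq; rewrite -e => -> _ /esym.
by move/eqP->.
Qed.

(* Main.v *)
Require Import Defs.
From mathcomp Require Import all_boot all_order all_fingroup all_algebra.
From mathcomp Require Import reals complex polyrcf.
From mathcomp Require Import ring lra zify.

Set Implicit Arguments.
Unset Strict Implicit.
Unset Printing Implicit Defensive.

Import Order.TTheory GRing.Theory Num.Theory.
Local Open Scope ring_scope.

(* The linear extensions of P_{m,n} are the shuffles of the two chains other
   than the identity, so W(P_{m,n}, t) = f(t) - 1 with
   f(t) = sum_k C(m,k) C(n,k) t^k.
   Put s = m + n and B = 1 / (2 s). The hypergeometric equation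
   t (1 - t) f'' + (1 + (s - 1) t) f' = m n f has three consequences.
   A monotone energy shows that f <> 1 on [-B, 0). A Sturm comparison gives a
   zero of f in (-2a, -a) as soon as 162 / (m n) < a <= B / 2, so that f, and by
   Rolle f', has arbitrarily many zeros in (-B, 0) when min(m, n) is large.
   Finally the roots of f - 1 have multiplicity at most 2. As the real roots of
   f - 1 other than 0 are all below -B, the zeros of f' in (-B, 0) are not among
   those that Rolle provides below -B, and counting degrees forces nonreal
   roots. *)

(** * Linear extensions and shuffles *)

Definition binom_poly (R : nzRingType) (m n : nat) : {poly R} :=
  \poly_(k < m.+1) ('C(m, k) * 'C(n, k))%:R.

Lemma coef_binom_poly (R : nzRingType) m n k :
  (binom_poly R m n)`_k = ('C(m, k) * 'C(n, k))%:R.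
Proof. by rewrite coef_poly ltnS; case: leqP => // lt_mk; rewrite bin_small. Qed.

(* A shuffle of the two chains is recorded by the word whose i-th letter tells
   whether the i-th entry lies in the first chain; its descents are the factors
   [false true]. The argument [b] plays the role of the letter before [w]. *)
Fixpoint ascents (b : bool) (w : bitseq) : nat :=
  if w is c :: w' then ((~~ b && c) + ascents c w')%N else 0%N.

Lemma ascentsE b w :
  ascents b w = ((~~ b && nth false w 0)
    + \sum_(i < size w) (~~ nth false w i && nth false w i.+1))%N.
Proof.
elim: w b => [|c w IHw] b /=; first by rewrite big_ord0 andbF.
by rewrite IHw big_ord_recl.
Qed.

Fixpoint words (p : nat) : seq bitseq :=
  if p is q.+1 then map (cons true) (words q) ++ map (cons false) (words q)
  else [:: [::]].

Lemma mem_words p w : (w \in words p) = (size w == p).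
Proof.
elim: p w => [|p IHp] [|c w] //=.
  by rewrite mem_cat; apply/orP => -[] /mapP[].
rewrite mem_cat eqSS -IHp; case: c.
  rewrite mem_map => [|? ? []//]; rewrite orbC.
  by case: mapP => [[? ? []]|].
rewrite orbC mem_map => [|? ? []//]; rewrite orbC.
by case: mapP => [[? ? []]|].
Qed.

Lemma words_uniq p : uniq (words p).
Proof.
elim: p => //= p IHp; rewrite cat_uniq !map_inj_uniq ?IHp //= ?andbT; try by move=> ? ? [].
by apply/hasPn => _ /mapP[w _ ->]; apply/mapP => -[].
Qed.

Definition words_poly (R : nzRingType) b p m : {poly R} :=
  \sum_(w <- words p | count id w == m) 'X^(ascents b w).

Section WordsPoly.
Variable R : nzRingType.
Local Notation S := (words_poly R).

Lemma words_polyS b p m :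
  S b p.+1 m = (if m is m'.+1 then 'X^(~~ b) * S true p m' else 0) + S false p m.
Proof.
rewrite /words_poly /= big_cat /= !big_map; congr (_ + _); last first.
  by apply: eq_big => [w|w _] /=; rewrite ?andbF.
case: m => [|m]; first by rewrite big_pred0 // => w.
rewrite mulr_sumr; apply: eq_big => [w|w _] /=; first by rewrite add1n eqSS.
by rewrite exprD andbT.
Qed.

Lemma words_poly_gt b p m : (p < m)%N -> S b p m = 0.
Proof.
move=> lt_pm; rewrite /words_poly big_seq_cond big_pred0 // => w.
rewrite mem_words; apply/andP => -[/eqP sz /eqP cw].
by move: lt_pm; rewrite -sz -cw ltnNge count_size.
Qed.

Lemma words_poly0 b p : S b p 0 = 1.
Proof.
elim: p b => [|p IHp] b; last by rewrite words_polyS add0r IHp.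
by rewrite /words_poly /= big_cons big_nil /= addr0.
Qed.

(** Pascal's rule, by a joint induction for both values of the preceding letter. In the second
    clause [k] counts the blocks of [true]: [m.+1] letters are cut into [k] blocks, placed in [k] of
    the [n.+1] gaps around the letters [false]. *)
Lemma coef_words_poly p :
  (forall m n k, p = (m + n)%N -> (S true p m)`_k = ('C(m, k) * 'C(n, k))%:R)
  /\ (forall m n k, p = (m.+1 + n)%N -> (S false p m.+1)`_k
        = (if k is k'.+1 then 'C(m, k') * 'C(n.+1, k'.+1) else 0)%:R).
Proof.
elim: p => [|p [IHt IHf]].
  split=> [] [|m] [|n] k // _; rewrite words_poly0 coef1.
  by case: k => //= k; rewrite bin0n.
split=> m n k pE.
  case: m pE => [|m] pE.
    by rewrite words_poly0 coef1; case: k => [|k]; rewrite ?bin0 ?bin0n.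
  rewrite words_polyS /= expr0 mul1r coefD (IHt m n); last lia.
  case: n pE => [|n] pE.
    rewrite words_poly_gt ?coef0 ?addr0; last lia.
    by case: k => [|k]; rewrite ?bin0 ?bin0n ?muln0.
  rewrite (IHf m n); last lia.
  by case: k => [|k]; rewrite -natrD ?bin0 // binS mulnDl.
rewrite words_polyS /= expr1 coefD coefXM.
(* For [n = 0] no such word exists, and ['C(0, k'.+1)] vanishes as well. *)
have -> : (S false p m.+1)`_k
    = (if k is k'.+1 then 'C(m, k') * 'C(n, k'.+1) else 0)%:R.
  case: n pE => [|n] pE; last by apply: IHf; lia.
  rewrite words_poly_gt ?coef0; last lia.
  by case: k => // k; rewrite bin0n muln0.
case: k => [|k] /=; first by rewrite addr0.
by rewrite (IHt m n); [rewrite -natrD binS mulnDr addnC | lia].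
Qed.
End WordsPoly.

Lemma words_poly_true (R : nzRingType) m n :
  words_poly R true (m + n) m = binom_poly R m n.
Proof.
by apply/polyP => k; have [e _] := coef_words_poly R (m + n); rewrite coef_binom_poly (e m n).
Qed.

(** * Permutations that shuffle the two chains *)

Lemma card_ord_lt (p : nat) (u : 'I_p) : #|[set v : 'I_p | (v < u)%N]| = u.
Proof.
have le_up : (u <= p)%N by apply: ltnW.
have widen_inj : injective (widen_ord le_up) by move=> x y [/val_inj].
rewrite -[RHS]card_ord -[RHS]cardsT -(card_imset _ widen_inj).
apply: eq_card => v; rewrite inE; apply/idP/imsetP => [vu|[w _ ->] /=//].
by exists (Ordinal vu) => //; apply: val_inj.
Qed.

(** Recovers a permutation from the order of its values alone. *)
Lemma perm_card_lt (p : nat) (s : 'S_p) (i : 'I_p) :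
  #|[set j | (s j < s i)%N]| = s i.
Proof.
rewrite -[RHS]card_ord_lt -(card_imset _ (@perm_inj _ s)); apply: eq_card => u.
rewrite inE; apply/imsetP/idP => [[j] + ->|ltu]; first by rewrite inE.
by exists (s^-1 u)%g; rewrite ?inE permKV.
Qed.

Lemma connect_homo (T : finType) (e : rel T) (h : T -> nat) x y :
  (forall x y, e x y -> h x < h y)%N -> connect e x y -> x != y -> (h x < h y)%N.
Proof.
move=> eh /connectP[q + ->]; elim: q x => [|z q IHq] x /=; first by rewrite eqxx.
move=> /andP[/eh xz /IHq zq] _; have [<-//|/zq] := eqVneq z (last z q).
exact: ltn_trans.
Qed.

Section Shuffles.
Variables m n : nat.
Implicit Types (s : 'S_(m + n)) (i j : 'I_(m + n)).

(** The linear extensions of the disjoint union of the two chains, in terms of positions. *)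
Definition shuffle s := [forall i, forall j,
  ((s i < m) == (s j < m)) ==> ((s i < s j) == (i < j))]%N.

Lemma shuffleP s :
  reflect (forall i j, (s i < m) = (s j < m) -> (s i < s j) = (i < j))%N (shuffle s).
Proof.
apply: (iffP forallP) => [h i j e|h i].
  by have /forallP/(_ j)/implyP := h i; rewrite e eqxx => /(_ isT)/eqP.
by apply/forallP => j; apply/implyP => /eqP /h ->.
Qed.

Lemma chain_connect (u v : 'I_(m + n)) :
  (u < v)%N -> (u < m)%N = (v < m)%N -> connect (@Pmn_gen m n) u v.
Proof.
case: u v => [a a_lt] [b b_lt] /=; elim: b b_lt => // b IHb b_lt.
rewrite ltnS leq_eqVlt => ab e.
have b_lt' : (b < m + n)%N by apply: ltnW.
have step : connect (@Pmn_gen m n) (Ordinal b_lt') (Ordinal b_lt).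
  apply: connect1; rewrite /Pmn_gen /= eqxx /=.
  by move: ab e; case: (leqP m b) => //= bm; lia.
move: ab => /predU1P[ab|ab].
  by subst b; rewrite (bool_irrelevance a_lt b_lt').
by apply: connect_trans step; apply: IHb => //; lia.
Qed.

Hypotheses (m_gt0 : (0 < m)%N) (n_gt0 : (0 < n)%N).

Lemma shuffle1 : shuffle 1%g.
Proof. by apply/shuffleP => i j; rewrite !perm1. Qed.

(** A shuffle violates the remaining relation only if the end of the first chain comes before the
    start of the second; then the whole first chain precedes the second and the shuffle is the
    identity. *)
Lemma linear_extensionsE :
  linear_extensions (@Pmn_le m n) = [set s | shuffle s & s != 1%g].
Proof.
have m_lt : (m < m + n)%N by rewrite -ltn_subLR ?subnn.
have m1_lt : (m.-1 < m + n)%N by rewrite ltn_addr // prednK.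
pose u0 := Ordinal m_lt; pose v0 := Ordinal m1_lt.
have gen0 : Pmn_gen u0 v0 by rewrite /Pmn_gen /= prednK // !eqxx !orbT.
apply/setP => s; rewrite !inE; apply/idP/andP => [sL|[/shuffleP sh s1]].
  have lt_inv i j : Pmn_le (s i) (s j) -> i != j -> (i < j)%N.
    move=> le ne; have /forallP/(_ (s i))/forallP/(_ (s j)) := sL.
    by rewrite !permK (inj_eq perm_inj) le ne => /implyP; apply.
  split.
    apply/shuffleP => i j e; have [->|ne] := eqVneq i j; first by rewrite !ltnn.
    have [lt|gt|/val_inj/perm_inj eq] := ltngtP (s i) (s j).
    - by rewrite lt_inv // /Pmn_le chain_connect.
    - have : (j < i)%N by rewrite lt_inv // 1?eq_sym // /Pmn_le chain_connect.
      by case: ltngtP.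
    by rewrite eq eqxx in ne.
  apply/eqP => s1; have : (u0 < v0)%N.
    apply: lt_inv; first by rewrite s1 !perm1 /Pmn_le connect1.
    by rewrite -val_eqE /= gtn_eqF // prednK.
  by rewrite /= ltnNge leq_pred.
have inv_lt (u v : 'I_(m + n)) : (u < v)%N -> (u < m)%N = (v < m)%N -> ((s^-1)%g u < (s^-1)%g v)%N.
  by move=> uv e; rewrite -sh !permKV.
suff gen_lt (u v : 'I_(m + n)) : Pmn_gen u v -> ((s^-1)%g u < (s^-1)%g v)%N.
  apply/forallP => u; apply/forallP => v; apply/implyP => /andP[].
  exact: connect_homo gen_lt.
case/or3P => /andP[/eqP e1 e2].
- by apply: inv_lt; rewrite e1 //; lia.
- by apply: inv_lt; rewrite e1 //; lia.
have -> : u = u0 by apply: val_inj.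
have -> : v = v0 by apply: val_inj; have /= <- := congr1 predn (eqP e2).
rewrite ltnNge; apply: contra s1 => v0u0.
have {}v0u0 : ((s^-1)%g v0 < (s^-1)%g u0)%N.
  rewrite ltn_neqAle v0u0 andbT val_eqE (inj_eq perm_inj) -val_eqE /=.
  by rewrite ltn_eqF // prednK.
(* Across the two chains, the comparison goes through [v0] and [u0]. *)
have inv_mono (x y : 'I_(m + n)) : (x < y)%N -> ((s^-1)%g x < (s^-1)%g y)%N.
  move=> xy; case: (ltnP x m) (ltnP y m) => xm [] ym; try by apply: inv_lt; lia.
    apply: leq_ltn_trans (leq_trans v0u0 _).
      have [->//|] := eqVneq x v0; rewrite -val_eqE /= => ne.
      by apply/ltnW/inv_lt => /=; lia.
    have [->//|] := eqVneq y u0; rewrite -val_eqE /= => ne.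
    by apply/ltnW/inv_lt => /=; lia.
apply/eqP/permP => i; rewrite perm1; apply: val_inj; rewrite /= -[LHS]perm_card_lt.
rewrite -[RHS]card_ord_lt; apply: eq_card => j; rewrite !inE.
have [lt|gt|/val_inj/perm_inj->] := ltngtP (s i) (s j); last by rewrite ltnn.
  by have := inv_mono _ _ lt; rewrite !permK; case: ltngtP.
by have := inv_mono _ _ gt; rewrite !permK => ->.
Qed.

(** * The bijection between shuffles and words *)

Definition word s : bitseq := [seq (s i < m)%N | i <- enum 'I_(m + n)].

Lemma size_word s : size (word s) = (m + n)%N.
Proof. by rewrite size_map size_enum_ord. Qed.

Lemma nth_word s i : nth false (word s) i = (s i < m)%N.
Proof. by rewrite (nth_map i) ?size_enum_ord // nth_ord_enum. Qed.

Lemma count_ord_lt : count (fun u : 'I_(m + n) => (u < m)%N) (enum 'I_(m + n)) = m.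
Proof.
rewrite -(count_map val (fun u => (u < m)%N)) val_enum_ord iotaD count_cat add0n.
rewrite (eq_in_count (a2 := predT)) => [|i]; last by rewrite mem_iota => /andP[_ ->].
rewrite count_predT size_iota (eq_in_count (a2 := pred0)) ?count_pred0 ?addn0 //.
by move=> i; rewrite mem_iota /= => /andP[+ _]; case: ltnP.
Qed.

Lemma count_word s : count id (word s) = m.
Proof.
rewrite count_map -[RHS]count_ord_lt -!sum1_count !big_enum_cond /=.
by rewrite [RHS](reindex_inj (@perm_inj _ s)).
Qed.

(** Each chain increases and the first carries the smaller labels, so a descent is a step from the
    second chain to the first. The initial letter [true] prevents an ascent at the start of the
    word. *)
Lemma des_word s : shuffle s -> des s = ascents true (word s).
Proof.
move=> /shuffleP sh; rewrite ascentsE add0n size_word /des -sum1_card.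
rewrite big_mkcond /=; apply: eq_bigr => i _; rewrite inE nth_word.
rewrite -[RHS]/(nat_of_bool _); congr nat_of_bool.
(* The default [false] makes the last position contribute nothing. *)
have [lt|ge] := ltnP i.+1 (m + n); last first.
  rewrite [nth _ _ i.+1]nth_default ?size_word // andbF.
  by apply/existsP => -[j /andP[/eqP ji _]]; have := ltn_ord j; rewrite ji ltnNge ge.
rewrite (nth_word s (Ordinal lt)); set j := Ordinal lt.
have ij : (i < j)%N by [].
apply/existsP/andP => [[k /andP[/eqP ki ks]]|[si sj]].
  have kj : k = j by apply: val_inj.
  rewrite -kj in ij *; have := sh k i.
  by rewrite ks; case: (ltnP (s i) m) (ltnP (s k) m) => a [] b e //;
    [move: (e erefl) | lia | move: (e erefl)]; case: ltngtP ij.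
by exists j; rewrite eqxx /=; lia.
Qed.

(* The total order on positions in which the entries of a shuffle with word [b]
   increase. *)
Definition pos_lt (b : 'I_(m + n) -> bool) j i :=
  if b j == b i then (j < i)%N else b j.

Lemma shuffle_lt s i j :
  shuffle s -> (s j < s i)%N = pos_lt (fun k => s k < m)%N j i.
Proof.
move=> /shuffleP sh; rewrite /pos_lt; case: eqP => [/sh//|].
by case: (ltnP (s j) m) (ltnP (s i) m) => a [] b //; lia.
Qed.

(** The word determines [pos_lt], hence the rank of each entry. *)
Lemma word_inj s t : shuffle s -> shuffle t -> word s = word t -> s = t.
Proof.
move=> sh_s sh_t st; apply/permP => i; apply: val_inj.
rewrite /= -[LHS]perm_card_lt -[RHS]perm_card_lt; apply: eq_card => j.
by rewrite !inE !shuffle_lt // /pos_lt -!nth_word st.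
Qed.

(** The permutation sends each position to its rank for the strict total order [pos_lt]. *)
Lemma word_surj w : size w = (m + n)%N -> count id w = m ->
  exists2 s, shuffle s & word s = w.
Proof.
move=> size_w count_w; pose b i := nth false w i.
have b_card : #|[set j | b j]| = m.
  rewrite -[RHS]count_w -sum1_card -sum1_count (big_nth false) size_w big_mkord.
  by apply: eq_bigl => j; rewrite inE.
pose lt := pos_lt b.
have lt_irr i : lt i i = false by rewrite /lt /pos_lt eqxx ltnn.
have lt_trans i j k : lt i j -> lt j k -> lt i k.
  by rewrite /lt /pos_lt; case: (b i) (b j) (b k) => [] [] [] //=; apply: ltn_trans.
have lt_total i j : i != j -> lt i j || lt j i.
  rewrite /lt /pos_lt -val_eqE /= neq_ltn.
  by case: (b i) (b j) => [] [] //=.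
pose r i := #|[set j | lt j i]|.
have r_mono i j : lt i j -> (r i < r j)%N.
  move=> ij; apply/proper_card/properP; split; last by exists i; rewrite inE // lt_irr.
  by apply/subsetP => k; rewrite !inE => /lt_trans; apply.
have r_lt i : (r i < m + n)%N.
  rewrite -[X in (_ < X)%N](card_ord (m + n)) -cardsT; apply/proper_card/properP.
  by split; [exact: subsetT | exists i; rewrite inE // lt_irr].
pose f i := Ordinal (r_lt i).
have f_inj : injective f.
  move=> i j /(congr1 val) /= eq_r; apply/eqP; apply: contraT => /lt_total.
  by case/orP => /r_mono; rewrite eq_r ltnn.
pose s := perm f_inj.
have s_lt i j : (s i < s j)%N = lt i j.
  rewrite !permE /=; apply/idP/idP => [|/r_mono//]; apply: contraLR => nij.
  have [->|/lt_total] := eqVneq i j; first by rewrite ltnn.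
  by rewrite (negPf nij) /= -leqNgt => /r_mono/ltnW.
(* The positions with letter [true] come first in this order, and there are [m] of them. *)
have s_b i : (s i < m)%N = b i.
  rewrite permE /=; case bi: (b i).
    rewrite -[X in (_ < X)%N]b_card; apply/proper_card/properP; split.
      by apply/subsetP => j; rewrite !inE /lt /pos_lt bi; case: (b j).
    by exists i; rewrite inE // lt_irr.
  apply/negbTE; rewrite -leqNgt -[X in (X <= _)%N]b_card; apply/subset_leq_card/subsetP => j.
  by rewrite !inE /lt /pos_lt bi => ->.
exists s; first by apply/shuffleP => i j; rewrite !s_b s_lt /lt /pos_lt => ->; rewrite eqxx.
apply: (@eq_from_nth _ false) => [|i]; rewrite size_word // => i_lt.
by rewrite (nth_word s (Ordinal i_lt)) s_b.
Qed.

Lemma sum_shuffle (R : nzRingType) :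
  \sum_(s | shuffle s) 'X^(des s) = binom_poly R m n.
Proof.
rewrite -words_poly_true /words_poly -(big_filter (words _)).
rewrite (eq_bigr (fun s => 'X^(ascents true (word s)))) => [|s /des_word->//].
rewrite -big_enum -(big_map word predT (fun w => 'X^(ascents true w))).
apply: perm_big; apply: uniq_perm.
- rewrite map_inj_in_uniq ?enum_uniq // => s t; rewrite !mem_enum.
  exact: word_inj.
- by rewrite filter_uniq ?words_uniq.
move=> w; rewrite mem_filter mem_words; apply/mapP/andP.
  by case=> s _ ->; rewrite count_word size_word !eqxx.
case=> /eqP cw /eqP sw; have [s sh ws] := word_surj sw cw.
by exists s; rewrite ?mem_enum.
Qed.

Lemma Wpoly_Pmn (R : nzRingType) : Wpoly R (@Pmn_le m n) = binom_poly R m n - 1.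
Proof.
apply/eqP; rewrite eq_sym subr_eq -sum_shuffle (bigD1 1%g shuffle1) /= addrC.
have -> : des (1%g : 'S_(m + n)) = 0%N.
  apply/eqP; rewrite cards_eq0; apply/eqP/setP => i; rewrite !inE.
  by apply/existsP => -[j]; rewrite !perm1 => /andP[/eqP->]; rewrite ltnNge leqnSn.
rewrite expr0 /Wpoly linear_extensionsE; apply/eqP; congr (_ + 1).
by apply: eq_bigl => s; rewrite inE.
Qed.
End Shuffles.

(** * The hypergeometric equation *)

Lemma map_binom_poly (R S : nzRingType) (h : {rmorphism R -> S}) m n :
  map_poly h (binom_poly R m n) = binom_poly S m n.
Proof. by apply/polyP=> k; rewrite coef_map !coef_binom_poly /= rmorph_nat. Qed.

Lemma horner0_binom_poly (R : nzRingType) m n : (binom_poly R m n).[0] = 1.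
Proof. by rewrite horner_coef0 coef_binom_poly !bin0. Qed.

Lemma horner0_deriv_binom_poly (R : nzRingType) m n :
  (binom_poly R m n)^`().[0] = (m * n)%:R.
Proof. by rewrite horner_coef0 coef_deriv coef_binom_poly !bin1. Qed.

Definition horner_ringE := (hornerD, hornerN, hornerM, hornerZ, hornerX, hornerC).

(** Lets [ring] deduce one equation from another: only an identity between the differences
    remains. *)
Lemma eq_of_sub (V : zmodType) (a b c d : V) : a = b -> c - d = a - b -> c = d.
Proof. by move=> ->; rewrite subrr => /eqP; rewrite subr_eq0 => /eqP. Qed.

(* The hypergeometric equation of 2F1(-m, -n; 1; t). *)
Lemma binom_poly_ode (R : comNzRingType) m n (f := binom_poly R m n) :
  'X * (1 - 'X) * f^`()^`() + (1 + ((m + n)%:R - 1) *: 'X) * f^`()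
    = (m * n)%:R *: f.
Proof.
(* The differential equation read on coefficients. *)
have rec k : (k.+1%:R ^+ 2) * f`_k.+1 = (m%:R - k%:R) * (n%:R - k%:R) * f`_k :> R.
  have step p : k.+1%:R * 'C(p, k.+1)%:R = (p%:R - k%:R) * 'C(p, k)%:R :> R.
    rewrite -natrM mul_bin_left; case: (leqP k p) => [le_kp|lt_pk].
      by rewrite natrM natrB.
    by rewrite bin_small // muln0 mulr0.
  rewrite !coef_binom_poly !natrM.
  transitivity ((k.+1%:R * 'C(m, k.+1)%:R) * (k.+1%:R * 'C(n, k.+1)%:R) : R).
    by ring.
  by rewrite !step; ring.
have -> : 'X * (1 - 'X) * f^`()^`() + (1 + ((m + n)%:R - 1) *: 'X) * f^`()
    = 'X * f^`()^`() - 'X * ('X * f^`()^`()) + f^`()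
      + ((m + n)%:R - 1) *: ('X * f^`()).
  by rewrite mulrDl -scalerAl; ring.
apply/polyP=> k; rewrite !(coefD, coefN, coefZ, coefXM) !coef_deriv.
move: {rec}(rec k); rewrite natrD natrM; clearbody f.
have nat_scale (x : R) i : x *+ i = x * i%:R by rewrite mulr_natr.
case: k => [|[|k]]; rewrite ?eqxx ?coef_deriv /= !{1}(nat_scale f`_ _).
- by move: (f`_1) (f`_0) => x y e; apply: (eq_of_sub e); ring.
- by move: (f`_2) (f`_1) => x y e; apply: (eq_of_sub e); ring.
move: (f`_k.+3) (f`_k.+2) => x y e; apply: (eq_of_sub e).
by rewrite (nat_scale (x * _)) (nat_scale (y * _)) -(natr1 k.+2) -!(natr1 k.+1) -!(natr1 k); ring.
Qed.

Lemma binom_poly_odeE (R : comNzRingType) m n (f := binom_poly R m n) (t : R) :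
  t * (1 - t) * f^`()^`().[t] + (1 + ((m + n)%:R - 1) * t) * f^`().[t]
    = (m * n)%:R * f.[t].
Proof.
have := congr1 (fun p => p.[t]) (binom_poly_ode R m n); rewrite /= -/f.
by rewrite !horner_ringE => <-.
Qed.

(* The energy [m n f^2 - t (1 - t) f'^2] equals [m n] at [t = 0] and, by the
   differential equation, has derivative [(1 + 2 (m + n) t) f'^2]. *)
Lemma binom_poly_neq1 (R : rcfType) m n (f := binom_poly R m n) (t : R) :
  (0 < m)%N -> (0 < n)%N -> - (2 * (m + n)%:R)^-1 <= t -> t < 0 -> f.[t] != 1.
Proof.
move=> m0 n0 tge t0; apply/eqP => ft1.
pose mu : R := (m * n)%:R; pose s : R := (m + n)%:R.
have mu0 : 0 < mu by rewrite ltr0n muln_gt0 m0.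
have s0 : 0 < s by rewrite ltr0n addn_gt0 m0.
pose E : {poly R} := mu *: f ^+ 2 - 'X * (1 - 'X) * f^`() ^+ 2.
have EE u : E.[u] = mu * f.[u] ^+ 2 - u * (1 - u) * f^`().[u] ^+ 2.
  by rewrite /E !expr2 !horner_ringE; ring.
have dE u : E^`().[u] = (1 + 2 * s * u) * f^`().[u] ^+ 2.
  rewrite /E !expr2 !derivE !horner_ringE.
  have := binom_poly_odeE m n u; rewrite -/f -/mu -/s => e.
  apply: (eq_of_sub (congr1 (fun v => - 2 * f^`().[u] * v) e)); ring.
have ge_s u : t <= u -> 0 <= 1 + 2 * s * u.
  move=> tu; have : - (2 * s)^-1 <= u by exact: le_trans tge tu.
  rewrite -(ler_pM2l (_ : 0 < 2 * s)) ?mulr_gt0 //.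
  by rewrite mulrN divff ?gt_eqF ?mulr_gt0 // => h; lra.
have homo u v : t <= u -> u < v -> E.[u] <= E.[v].
  move=> tu uv; have [c /andP[uc cv] e] := poly_mvt E uv.
  rewrite -subr_ge0 e mulr_ge0 ?subr_ge0 ?(ltW uv) // dE.
  rewrite mulr_ge0 ?sqr_ge0 // ge_s //.
  by apply: le_trans tu _; move: uc; rewrite bnd_simp => /ltW.
have E0 : E.[0] = mu.
  by rewrite EE /f horner0_binom_poly; ring.
(* If [f] is 1 at [t < 0], the second term of [E] is nonnegative there; as [E] increases to [mu] at
   0, it is constant on [[t, 0]]. *)
have Et : mu <= E.[t].
  rewrite EE ft1 expr1n mulr1 lerBrDr -subr_ge0 opprD addrA subrr sub0r.
  rewrite -mulNr -mulNr mulr_ge0 ?sqr_ge0 // mulr_ge0 ?oppr_ge0 ?(ltW t0) //.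
  by lra.
have Ecst u : t <= u -> u < 0 -> root (E - mu%:P) u.
  move=> tu u0; rewrite /root hornerD hornerN hornerC subr_eq0 eq_le -{1}E0 homo //=.
  have [<-//|ne] := eqVneq t u; apply: le_trans Et (homo _ _ _ _) => //.
  by rewrite lt_neqAle ne.
(* The derivative of [E] at 0 is [mu ^+ 2], so [E] is not a constant polynomial. *)
have Enz : E - mu%:P != 0.
  apply/eqP => e; have := dE 0.
  have -> : E = mu%:P by apply/eqP; rewrite -subr_eq0 e.
  rewrite derivC hornerC /f horner0_deriv_binom_poly -/mu => /eqP.
  by rewrite mulr0 addr0 mul1r eq_sym expf_eq0 gt_eqF.
pose r := [seq t / i.+1%:R | i <- iota 0 (size (E - mu%:P))].
have : (size r < size (E - mu%:P)%R)%N.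
  apply: max_poly_roots => //.
    apply/allP => _ /mapP[i _ ->]; apply: Ecst.
      by rewrite ler_pdivlMr ?ltr0n // -[leRHS]mulr1 ler_nM2l // ler1n.
    by rewrite pmulr_llt0 // invr_gt0 ltr0n.
  rewrite map_inj_uniq ?iota_uniq // => i j /(mulfI _)/invr_inj.
  by rewrite lt_eqF // => /(_ isT)/eqP; rewrite eqr_nat => /eqP[].
by rewrite size_map size_iota ltnn.
Qed.

(* The coefficient of [f] in the derivative of the concomitant [V] of the next
   lemma, with [mu = m n] and [s = m + n]. *)
Lemma concomitant_factor_gt0 (R : realFieldType) (mu s a t : R) :
  0 < a -> 2 <= s -> 162 < mu * a -> 2 * a <= (2 * s)^-1 ->
  - (2 * a) < t -> t < - a ->
  0 < (mu + s + 1) * ((t + a) ^+ 2 * (t + 2 * a) ^+ 2)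
      - t * (1 - t) * (2 * (a ^+ 2 + 6 * (t + a) * (t + 2 * a)))
      + ((s + 1) * t - (1 - 2 * t)) * (2 * (t + a) * (t + 2 * a) * (2 * t + 3 * a)).
Proof.
move=> a0 s2 mua sa t1 t2.
have s0 : 0 < s by lra.
have {}sa : s * a <= 4^-1.
  by move: sa; rewrite -[(2 * s)^-1]mul1r ler_pdivlMr; [lra | lra].
have a8 : a <= 8^-1 by nra.
set x := - t; pose sg := (- (t + a)) * (t + 2 * a).
have [xa x2a] : a < x /\ x < 2 * a by rewrite /x; split; lra.
have sg0 : 0 < sg by rewrite mulr_gt0 //; lra.
set k := (s + 1) * x + (1 + 2 * x).
have [k0 k3] : 0 < k /\ k <= 3 by rewrite /k; split; nra.
pose w := 2 * t + 3 * a.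
have [w1 w2] : - a <= w /\ w <= a by rewrite /w; split; lra.
have -> : (mu + s + 1) * ((t + a) ^+ 2 * (t + 2 * a) ^+ 2)
      - t * (1 - t) * (2 * (a ^+ 2 + 6 * (t + a) * (t + 2 * a)))
      + ((s + 1) * t - (1 - 2 * t)) * (2 * (t + a) * (t + 2 * a) * (2 * t + 3 * a))
    = (mu + s + 1) * sg ^+ 2 + x * (1 + x) * (2 * (a ^+ 2 - 6 * sg))
      + k * (2 * sg * w).
  by rewrite /k /sg /x /w; ring.
have third : - (6 * a * sg) <= k * (2 * sg * w).
  have : - (3 * a) <= k * w by nra.
  nra.
have second : 2 * a ^+ 3 - 30 * a * sg <= x * (1 + x) * (2 * (a ^+ 2 - 6 * sg)).
  have xx1 : a <= x * (1 + x) by nra.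
  have xx2 : x * (1 + x) <= 5 / 2 * a by nra.
  have : a ^+ 2 * a <= a ^+ 2 * (x * (1 + x)) by rewrite ler_pM2l // exprn_gt0.
  have : sg * (x * (1 + x)) <= sg * (5 / 2 * a) by rewrite ler_pM2l.
  nra.
have first : 162 * sg ^+ 2 < a * ((mu + s + 1) * sg ^+ 2).
  have -> : a * ((mu + s + 1) * sg ^+ 2) = (mu * a + (s + 1) * a) * sg ^+ 2 by ring.
  by rewrite ltr_pM2r ?exprn_gt0 //; nra.
rewrite -(pmulr_rgt0 _ a0) !(mulrDr a).
(* After multiplication by [a], the three bounds add up to [162 sg^2 - 36 a^2 sg + 2 a^4 = 2 (9 sg -
   a^2)^2]; this is the origin of the constant 162. *)
have := sqr_ge0 (9 * sg - a ^+ 2).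
move: second third; rewrite -(ler_pM2l a0) => second; rewrite -(ler_pM2l a0) => third.
move: first second third.
move: (a * ((mu + s + 1) * _)) (a * (_ * (2 * (_ - _)))) (a * (k * _)) => A1 A2 A3.
by lra.
Qed.

(* Rolle applied to the bilinear concomitant [V] of [f] and of a test function
   [p] with double zeros at both ends: [V'] is [f] times a positive factor. *)
Lemma binom_poly_has_root (R : rcfType) m n (f := binom_poly R m n) (a : R) :
  0 < a -> (2 <= m + n)%N -> 162 < (m * n)%:R * a ->
  2 * a <= (2 * (m + n)%:R)^-1 ->
  exists2 t : R, - (2 * a) < t < - a & f.[t] = 0.
Proof.
move=> a0 mn2 mua sa; pose s : R := (m + n)%:R; pose mu : R := (m * n)%:R.
pose p : {poly R} := ('X + a%:P) ^+ 2 * ('X + (2 * a)%:P) ^+ 2.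
(* The last term turns the coefficient [1 - 2 t] of [f' p] in [V'] into [1 + (s - 1) t], as in the
   differential equation. *)
pose V : {poly R} := 'X * (1 - 'X) * (f^`() * p - f * p^`())
  + (s + 1) *: ('X * p * f).
have lt2a : - (2 * a) < - a by lra.
have pE u : p.[u] = (u + a) ^+ 2 * (u + 2 * a) ^+ 2.
  by rewrite /p !expr2 !horner_ringE.
have dpE u : p^`().[u] = 2 * (u + a) * (u + 2 * a) * (2 * u + 3 * a).
  by rewrite /p !expr2 !derivE !horner_ringE; ring.
have ddpE u : p^`()^`().[u] = 2 * (a ^+ 2 + 6 * (u + a) * (u + 2 * a)).
  by rewrite /p !expr2 !derivE !horner_ringE; ring.
have VE u : V.[u] = u * (1 - u) * (f^`().[u] * p.[u] - f.[u] * p^`().[u])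
    + (s + 1) * (u * p.[u] * f.[u]) by rewrite /V !horner_ringE.
have Va : V.[- (2 * a)] = V.[- a].
  by rewrite !VE !pE !dpE; ring.
have [t t_in] := poly_rolle lt2a Va.
(* The factor of [q] is the left-hand side of the differential equation for [h]. *)
have dVE (h q : {poly R}) u :
    ('X * (1 - 'X) * (h^`() * q - h * q^`()) + (s + 1) *: ('X * q * h))^`().[u]
  = q.[u] * (u * (1 - u) * h^`()^`().[u] + (1 + (s - 1) * u) * h^`().[u])
    + h.[u] * ((s + 1) * q.[u] - u * (1 - u) * q^`()^`().[u]
               + ((s + 1) * u - (1 - 2 * u)) * q^`().[u]).
  by rewrite !derivE !horner_ringE; ring.
rewrite dVE binom_poly_odeE -/mu mulrCA [p.[t] * _]mulrC [mu * (_ * _)]mulrCA -mulrDr.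
rewrite !addrA -mulrDl addrA.
move=> /eqP; rewrite mulf_eq0 pE dpE ddpE => /orP[/eqP ft|].
  by exists t.
have [t1 t2] : - (2 * a) < t /\ t < - a by apply/andP.
rewrite gt_eqF // concomitant_factor_gt0 //.
by rewrite (ler_nat _ 2).
Qed.

(** * Counting roots *)

(** Rolle between consecutive roots. The last clause keeps the critical points apart from the given
    roots, so that double roots can be counted in addition. *)
Lemma rolle_path (R : rcfType) (p : {poly R}) (x : R) (s : seq R) :
  path <%R x s -> all (root p) (x :: s) ->
  exists s' : seq R,
    [/\ sorted <%R s', size s' = size s, all (root p^`()) s',
        {in s', forall y, x < y < last x s} & {in s', forall y, y \notin x :: s}].
Proof.
elim: s x => [|y s IHs] x /=; first by exists [::].
move=> /andP[xy ys] /and3P[px py ps].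
have [|s' [s's szs' ps' s'in s'out]] := IHs y ys; first by rewrite /= py.
have [||c /andP[] ] := @poly_rolle _ x y p; rewrite ?(rootP px) ?(rootP py) //.
rewrite !bnd_simp => xc cy dpc.
have y_last : y <= last y s.
  have := ys; rewrite lt_path_sortedE => /andP[/allP ysP _].
  by have := mem_last y s; rewrite inE => /predU1P[->//|/ysP/ltW].
exists (c :: s'); split => /=.
- rewrite (path_sortedE lt_trans) s's andbT; apply/allP => z /s'in /andP[yz _].
  exact: lt_trans yz.
- by rewrite szs'.
- by rewrite ps' andbT; apply/rootP.
- move=> z; rewrite inE => /predU1P[->|/s'in/andP[yz ->]].
    by rewrite xc (lt_le_trans cy).
  by rewrite (lt_trans xy).
move=> z; rewrite inE => /predU1P[->|zs'].
  rewrite !inE gt_eqF // lt_eqF //=; apply/negP => cs.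
  have := ys; rewrite lt_path_sortedE => /andP[/allP/(_ _ cs) yc _].
  by have := lt_trans cy yc; rewrite ltxx.
rewrite inE negb_or s'out // andbT gt_eqF //.
by have /andP[yz _] := s'in _ zs'; apply: lt_trans yz.
Qed.

(** Bounds a degree by the number of distinct roots plus the number of double ones, which [a]
    selects. *)
Lemma size_le_undup_double (T : eqType) (a : pred T) (s : seq T) :
  (forall x, (count_mem x s <= 1 + a x)%N) ->
  (size s <= size (undup s) + count a (undup s))%N.
Proof.
move=> s_le.
have -> : size s = (\sum_(x <- undup s) count_mem x s)%N.
  rewrite -(perm_size (perm_count_undup s)) size_flatten /shape -map_comp.
  by rewrite sumnE big_map; apply: eq_bigr => x _ /=; rewrite size_nseq.
have -> : (size (undup s) + count a (undup s) = \sum_(x <- undup s) (1 + a x))%N.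
  by rewrite big_split /= sum1_size; congr addn; rewrite -sum1_count big_mkcond.
by apply: leq_sum.
Qed.

(** A factor [('X - x)^3] would make [p], [p'] and [p''] vanish at [x], and a factor [('X - x)^2]
    makes [p'] vanish there. *)
Lemma count_roots_le (F : fieldType) (p : {poly F}) (s : seq F) (c : F) x :
    p = c *: \prod_(z <- s) ('X - z%:P) ->
    ~~ [&& root p x, root p^`() x & root p^`()^`() x] ->
  (count_mem x s <= 1 + root p^`() x)%N.
Proof.
move=> pE simple_enough.
have factor k : (k <= count_mem x s)%N -> exists q, p = q * ('X - x%:P) ^+ k.
  move=> le_k; rewrite pE (bigID (pred1 x)) /= (eq_bigr (fun=> 'X - x%:P)); last first.
    by move=> z /eqP->.
  rewrite -[X in _ *: (X * _)](big_filter _ (pred1 x)) big_const_seq count_predT.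
  rewrite size_filter -Monoid.iteropE.
  exists (c *: (('X - x%:P) ^+ (count_mem x s - k) * \prod_(z <- s | z != x) ('X - z%:P))).
  rewrite -scalerAl mulrAC -exprD subnK //.
have [/factor[q pq]|lt3] := leqP 3 (count_mem x s).
  case/negP: simple_enough; rewrite pq /root !exprS expr0 !derivE.
  by rewrite !(hornerD, hornerM, hornerN, hornerX, hornerC) subrr !(mul0r, mulr0, addr0) eqxx.
have [/factor[q pq]|lt2] := leqP 2 (count_mem x s); last first.
  by apply: leq_trans (leq_addr _ _).
suff -> : root p^`() x by [].
rewrite pq /root !exprS expr0 !derivE.
by rewrite !(hornerD, hornerM, hornerN, hornerX, hornerC) subrr !(mul0r, mulr0, addr0).
Qed.

Local Open Scope complex_scope.

(* A real root of [P] below [b] costs, by Rolle, a root of [P'] below [b], and a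
   double root of [P] is itself a root of [P']; since [P'] has fewer than
   [deg P] distinct roots, the roots [ks] of [P'] force nonreal roots of [P]. *)
Lemma nonreal_roots_ge (R : rcfType) (P : {poly R}) (b : R) (ks : seq R)
    (toC := map_poly (real_complex R)) :
    (1 < size P)%N -> ~~ root P^`() 0 ->
    (forall x, root P x -> x = 0 \/ x < b) ->
    (forall z, root (toC P) z -> root (toC P^`()) z -> ~~ root (toC P^`()^`()) z) ->
    uniq ks -> all (root P^`()) ks -> {in ks, forall x, b <= x} ->
  exists zs : seq R[i],
    [/\ uniq zs, (size ks <= (size zs).+1)%N &
        forall z, z \in zs -> root (toC P) z /\ z \isn't Num.real].
Proof.
move=> P1 dP0 realP multP ks_uniq dPks ks_ge.
have CE (x : R) : x%:C \is Num.real by rewrite complex_real.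
have rootC (p : {poly R}) x : root (toC p) x%:C = root p x.
  by rewrite /toC fmorph_root.
have dC p : (toC p)^`() = toC p^`() by rewrite /toC deriv_map.
have CI : injective (real_complex R) by apply: fmorph_inj.
have sizeC p : size (toC p) = size p by rewrite size_map_poly.
have PC0 : toC P != 0 by rewrite -size_poly_gt0 sizeC; apply: leq_trans P1.
have [r Pr] := closed_field_poly_normal (toC P).
have size_r : (size P).-1 = size r.
  by rewrite -(sizeC P) Pr size_scale ?lead_coef_eq0 // size_prod_XsubC.
have mem_r z : (z \in r) = root (toC P) z.
  by rewrite Pr rootZ ?lead_coef_eq0 // root_prod_XsubC.
have r_le : (size r <= size (undup r) + count (root (toC P^`())) (undup r))%N.
  apply: size_le_undup_double => x; rewrite -dC; apply: count_roots_le Pr _.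
  rewrite !dC; apply/negP => /and3P[h1 h2]; apply/negP; exact: multP.
(* The multiple roots of [P]. *)
set e := filter (root (toC P^`())) (undup r).
pose zs := [seq z <- undup r | z \isn't Num.real].
pose rr := sort <=%R [seq x <- [seq complex.Re z | z <- undup r & z \is Num.real] | x < b].
have rrP x : (x \in rr) = root P x && (x < b).
  rewrite mem_sort mem_filter andbC; congr andb; rewrite -rootC -mem_r.
  apply/mapP/idP => [[z]|xr].
    by rewrite mem_filter mem_undup => /andP[zre zr] ->; rewrite RRe_real.
  by exists x%:C; rewrite // mem_filter mem_undup CE.
have rr_sorted : sorted <%R rr.
  rewrite sort_lt_sorted filter_uniq // map_inj_in_uniq ?filter_uniq ?undup_uniq //.
  move=> z w; rewrite !mem_filter => /andP[zre _] /andP[wre _] ezw.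
  by rewrite -(RRe_real zre) -(RRe_real wre) ezw.
(* A root of [P] is 0, a real number below [b], or nonreal. *)
have u_le : (size (undup r) <= 1 + size rr + size zs)%N.
  have -> : (1 + size rr + size zs = size (0%:C :: map (real_complex R) rr ++ zs))%N.
    by rewrite /= size_cat size_map.
  apply: uniq_leq_size (undup_uniq r) _ => z; rewrite mem_undup => zr.
  rewrite inE mem_cat mem_filter mem_undup zr andbT.
  have [zre|//] := boolP (z \is Num.real); last by rewrite !orbT.
  have [x zx] := complex_realP _ zre; rewrite zx in zr *.
  move: zr; rewrite mem_r rootC => Px.
  have [->|xb] := realP x Px; first by rewrite eqxx.
  by rewrite mem_map // rrP Px xb orbT.
(* Since [rr] lists all the roots of [P] below [b], the Rolle points between them are not roots of
   [P]. *)
have [rl [rl_uniq rl_size drl rl_lt rl_out]] : exists s : seq R,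
    [/\ uniq s, (size rr <= (size s).+1)%N, all (root P^`()) s,
      {in s, forall y, y < b} & {in s, forall y, ~~ root P y}].
  have : all (fun x => root P x && (x < b)) rr by apply/allP => x; rewrite rrP.
  move: rr_sorted rrP; clear u_le; case: rr => [|x s] /=; first by exists [::].
  move=> xs memP /andP[/andP[Px xb] ys].
  have [|s' [s's szs' ps' s'in s'out]] := @rolle_path R P x s xs.
    by rewrite /= Px; apply: sub_all ys => y /andP[].
  have lb : last x s < b.
    by have := mem_last x s; rewrite inE => /predU1P[->//|]; move/(allP ys) => /andP[].
  exists s'; split => //.
  - exact: lt_sorted_uniq s's.
  - by rewrite szs'.
  - by move=> y /s'in/andP[_ yl]; apply: lt_trans lb.
  move=> y ys'; have := s'out y ys'; rewrite memP; apply: contra => ->.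
  by have /andP[_ yl] := s'in y ys'; apply: lt_trans lb.
(* Distinct roots of [P']: those of [ks] and [rl] are separated by [b], and neither are roots of
   [P], unlike those of [e]. *)
pose L := map (real_complex R) (ks ++ rl) ++ e.
have ksP x : x \in ks -> ~~ root P x.
  move=> xks; apply/negP => /realP[x0|]; last by rewrite ltNge ks_ge.
  by move: dP0; rewrite -x0 (allP dPks).
have L_uniq : uniq L.
  rewrite cat_uniq map_inj_uniq // cat_uniq ks_uniq rl_uniq andbT /=.
  rewrite filter_uniq ?undup_uniq // andbT; apply/andP; split.
    by apply/hasPn => x /rl_lt xb; apply/negP => /ks_ge; rewrite leNgt xb.
  apply/hasPn => z; rewrite mem_filter mem_undup mem_r => /andP[_ Pz].
  apply/negP => /mapP[x]; rewrite mem_cat => xin zx; move: Pz; rewrite zx rootC.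
  by apply/negP; case/orP: xin => [/ksP|/rl_out].
have dP_neq0 : toC P^`() != 0.
  by rewrite -size_poly_gt0 sizeC size_poly_gt0; apply: contraNneq dP0 => ->; exact: root0.
have L_size : (size L < size P^`())%N.
  rewrite -(sizeC P^`()); apply: max_poly_roots L_uniq => //.
  apply/allP => z; rewrite mem_cat mem_filter => /orP[/mapP[x xin ->]|/andP[]//].
  by rewrite rootC; move: xin; rewrite mem_cat => /orP[/(allP dPks)|/(allP drl)].
have dP_size : (size P^`() <= (size P).-1)%N.
  by rewrite -ltnS prednK ?lt_size_deriv -?size_poly_gt0 // (leq_trans _ P1).
exists zs; split; first by rewrite filter_uniq ?undup_uniq.
  (* [|ks| + |rl| + |e| < deg P <= 1 + |rr| + |zs| + |e|], and [|rr| <= |rl| + 1]. *)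
  move: L_size r_le; rewrite -size_filter -/e size_cat size_map size_cat.
  move: size_r u_le rl_size dP_size.
  move: (size r) (size (undup r)) (size e) (size zs) (size ks) (size rl) (size rr).
  move: (size P) (size P^`()) => a b' c d f g h i j; clear. lia.
by move=> z; rewrite mem_filter mem_undup mem_r => /andP[].
Qed.

Local Close Scope complex_scope.

(** * Nonreal roots *)

(** One zero in each of the disjoint intervals from [- 2^(k+1) a] to [- 2^k a], [k <= K]. The lower
    bound on the length is tightest at [k = 0], the upper bound at [k = K]. *)
Lemma binom_poly_roots (R : rcfType) m n (f := binom_poly R m n) (a : R) K :
  0 < a -> (2 <= m + n)%N -> 162 < (m * n)%:R * a ->
  2 * (a * 2 ^+ K) <= (2 * (m + n)%:R)^-1 ->
  exists x : R, exists s : seq R,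
    [/\ path <%R x s, size s = K, all (root f) (x :: s),
        - (2 * (a * 2 ^+ K)) < x & last x s < 0].
Proof.
move=> a0 mn2 mua; elim: K => [|K IHK] le_K.
  move: le_K; rewrite expr0 mulr1 => /(binom_poly_has_root a0 mn2 mua)[x].
  move=> /andP[x1 x2] fx; exists x, [::]; split => //=; last by lra.
  by rewrite andbT; apply/rootP.
have a2K : a <= a * 2 ^+ K.+1 by rewrite ler_peMr ?exprn_ege1 ?ltW //; lra.
have aK : 0 < a * 2 ^+ K by rewrite mulr_gt0 ?exprn_gt0.
move: a2K le_K; rewrite exprS mulrCA => a2K le_K.
have [|x [s [xs szs fs lt_x lt_l]]] := IHK; first by apply: le_trans le_K; lra.
have [||y /andP[y1 y2] fy] := @binom_poly_has_root R m n _ _ mn2 _ le_K; first by lra.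
  by apply: lt_le_trans mua _; rewrite ler_wpM2l.
exists y, (x :: s); split => //=.
- by rewrite xs andbT; lra.
- by rewrite szs.
- by move: fs => /= ->; rewrite andbT; apply/rootP.
Qed.

(** All coefficients are nonnegative, the constant one is 1 and the linear one is positive. *)
Lemma binom_poly_gt1 (R : realDomainType) m n (x : R) :
  (0 < m)%N -> (0 < n)%N -> 0 < x -> 1 < (binom_poly R m n).[x].
Proof.
case: m => // m _ n0 x0; rewrite horner_poly !big_ord_recl /= !bin0 !bin1.
rewrite muln1 expr0 mulr1 ltrDl ltr_pwDl //.
  by rewrite expr1 mulr_gt0 // ltr0n muln_gt0.
by apply: sumr_ge0 => i _; rewrite mulr_ge0 ?ler0n ?exprn_ge0 ?ltW.
Qed.

(** [K + 1] zeros of [f] in []-B, 0[] give [K] zeros of [f'] there; the count of roots loses one. *)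
Lemma binom_poly_nonreal_roots (R : rcfType) K m n :
    (0 < m)%N -> (0 < n)%N -> (163 * 2 ^ K * 8 < minn m n)%N ->
  exists zs : seq R[i],
    [/\ uniq zs, (K <= (size zs).+1)%N &
        forall z, z \in zs -> root (binom_poly R[i] m n - 1) z /\ z \isn't Num.real].
Proof.
move=> m0 n0 big.
pose f := binom_poly R m n; pose P := f - 1.
pose mu : R := (m * n)%:R; pose s : R := (m + n)%:R.
have mu0 : 0 < mu by rewrite ltr0n muln_gt0 m0.
have s0 : 0 < s by rewrite ltr0n addn_gt0 m0.
have mapP : map_poly (real_complex R) P = binom_poly R[i] m n - 1.
  by rewrite rmorphB /= rmorph1 map_binom_poly.
have dP : P^`() = f^`() by rewrite /P derivB -[1]/(1%:P) derivC subr0.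
have dP0 : ~~ root P^`() 0 by rewrite dP /root horner0_deriv_binom_poly gt_eqF.
pose a : R := 163 / mu.
have mua : 162 < mu * a by rewrite /a mulrC divfK ?gt_eqF //; lra.
have a0 : 0 < a by rewrite divr_gt0.
(* This amounts to [4 * 163 * 2^K * (m + n) <= m n], and [m + n] is at most twice the maximum of [m]
   and [n]. *)
have a_small : 2 * (a * 2 ^+ K) <= (2 * s)^-1.
  rewrite -[leRHS]mul1r ler_pdivlMr ?mulr_gt0 //.
  have -> : 2 * (a * 2 ^+ K) * (2 * s) = (4 * 163 * 2 ^+ K * s) / mu.
    by rewrite /a; ring.
  rewrite ler_pdivrMr // mul1r /s /mu -!natrX -!natrM ler_nat.
  move: big; rewrite leq_min; move: (2 ^ K)%N => q /andP[h1 h2].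
  have [le|le] := leqP m n; nia.
have [|x [l [xl szl fl lt_x lt_l]]] := @binom_poly_roots R m n a K a0 _ mua a_small.
  by lia.
have [ks [ks_sort ks_size dks ks_in _]] := rolle_path xl fl.
rewrite -ks_size in szl; rewrite -szl -mapP.
apply: (@nonreal_roots_ge R P (- (2 * s)^-1)) => //.
- rewrite ltnNge; apply: contra dP0 => /leq_sizeP/(_ 1%N isT) P1.
  by rewrite /root horner_coef0 coef_deriv P1 mul0rn.
- move=> y; rewrite /root /P hornerD hornerN hornerC subr_eq0 => /eqP fy.
  have [y0|y0|->] := ltgtP y 0; [right | | by left].
    by rewrite ltNge; apply/negP => /binom_poly_neq1 /(_ y0); rewrite fy eqxx => /(_ m0 n0).
  by have := binom_poly_gt1 m0 n0 y0; rewrite fy ltxx.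
(* At a triple root of [f - 1] the differential equation would read [0 = m n]. *)
- move=> z; rewrite mapP -!deriv_map mapP => /rootP Pz; rewrite derivB -[1]/(1%:P) derivC subr0.
  move=> /rootP dPz; apply/negP => /rootP ddPz.
  have := binom_poly_odeE m n z; rewrite dPz ddPz !mulr0 addr0.
  move: Pz; rewrite hornerD hornerN hornerC => /eqP; rewrite subr_eq0 => /eqP ->.
  by move/eqP; rewrite mulr1 eq_sym pnatr_eq0 muln_eq0 !gtn_eqF.
- exact: lt_sorted_uniq.
- by rewrite dP.
move=> y /ks_in/andP[xy _]; apply: ltW; apply: le_lt_trans xy; apply/ltW.
by apply: le_lt_trans lt_x; rewrite lerN2.
Qed.

Theorem mainTheorem1 (R : realType) (M : nat) (hM : (0 < M)%N) :
  exists N : nat, forall m n : nat,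
    (0 < m)%N -> (0 < n)%N -> (N < minn m n)%N ->
    exists zs : seq R[i],
      [/\ uniq zs, (M < size zs)%N &
          forall z : R[i], z \in zs ->
            root (Wpoly R[i] (@Pmn_le m n)) z /\ z \isn't Num.real].
Proof.
(* With [K = M + 2], at least [K - 1 = M + 1] nonreal roots remain. *)
exists (163 * 2 ^ M.+2 * 8)%N => m n m0 n0 big.
have [zs [zs_uniq zs_size zsP]] := @binom_poly_nonreal_roots R M.+2 m n m0 n0 big.
by exists zs; split=> // z /zsP; rewrite Wpoly_Pmn.
Qed.
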